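(* Let $d\ge 2$ and let $T=T_{(\lambda,\pi)}:[0,1)\to[0,1)$ be a $d$-interval exchange transformation with length data $\lambda$ and irreducible combinatorial data $\pi\in S_d$, and suppose that $T$ satisfies the infinite distinct orbit condition (i.d.o.c.). Then for every integer $N\ge 1$ the set $\operatorname{Gaps}_{T,N}$ of gap lengths of the orbit segment $\{T^n0\}_{n=0}^{N-1}$ satisfies: (i) if $\pi^{-1}(\pi(1)-1)=d$, then $\#\operatorname{Gaps}_{T,N}\le d+1$; (ii) if $\pi^{-1}(\pi(1)-1)\ne d$, then $\#\operatorname{Gaps}_{T,N}\le d+2$.
   Context: Interval exchange transformations: given $\lambda=(\lambda_1,\dots,\lambda_d)$ with $\lambda_i\ge 0$, $\sum_i\lambda_i=1$, and a permutation $\pi$ of $\{1,\dots,d\}$, put $I_i=[\sum_{k<i}\lambda_k,\sum_{k\le i}\lambda_k)$ and define $T=T_{(\lambda,\pi)}:[0,1)\to[0,1)$ by $T(x)=x-\sum_{k<i}\lambda_k+\sum_{\pi(k)<\pi(i)}\lambda_k$ for $x\in I_i$. This is a $d$-interval exchange transformation ($d$-IET). The permutation $\pi$ is irreducible if $\pi(\{1,\dots,k\})\ne\{1,\dots,k\}$ for every $1\le k<d$ (in particular $\pi(1)\geq 2$ when $d\ge2$). I.d.o.c.: let $\alpha_i=\sum_{\pi(k)\le i}\lambda_k$ for $0\le i\le d$ (so $\alpha_1,\dots,\alpha_{d-1}$ are the discontinuities of $T^{-1}$). $T$ satisfies the i.d.o.c. (Keane's condition) if the orbits $\{(T^{-1})^n\alpha_i\}_{n\ge1}$,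 $i=1,\dots,d-1$, are (defined and) infinite and pairwise disjoint. Gaps: order the $N$ points $T^n0$, $0\le n\le N-1$, as $0=y_0<y_1<\dots<y_{N-1}<1$ and put $y_N=1$. The gaps are $\operatorname{gap}_{T,N}(i)=y_{i+1}-y_i$, $0\le i<N$, and $\operatorname{Gaps}_{T,N}=\{\operatorname{gap}_{T,N}(i)\mid 0\le i<N\}$ as a set (without multiplicity). *)

(* Defs.v *)
From mathcomp Require Export all_boot all_order all_algebra all_fingroup.
From mathcomp Require Export boolp classical_sets functions cardinality.
From mathcomp Require Export reals.

Set Implicit Arguments.
Unset Strict Implicit.
Unset Printing Implicit Defensive.

Import Order.TTheory GRing.Theory Num.Theory.
Local Open Scope ring_scope.

(* Indices 1, ..., d are represented by the elements 0, ..., d-1 of 'I_d, so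
   the index written i in the mathematics is the ordinal of value i - 1. *)

Definition first_idx (d : nat) (hd : (2 <= d)%N) : 'I_d := Ordinal (ltnW hd).

Definition last_idx (d : nat) (hd : (2 <= d)%N) : 'I_d := rev_ord (first_idx hd).

Definition irreducible_perm (d : nat) (pi : 'S_d) : Prop :=
  forall k : nat, (1 <= k < d)%N ->
    (pi @: [set i : 'I_d | (i < k)%N] != [set i : 'I_d | (i < k)%N])%SET.

Local Open Scope classical_set_scope.

Section IntervalExchange.
Variables (R : realType) (d : nat).
Implicit Types (lam : 'I_d -> R) (pi : 'S_d).

Definition length_data lam : Prop :=
  (forall i, 0 <= lam i) /\ \sum_(i < d) lam i = 1.

Definition iet_interval lam (i : 'I_d) : interval R :=
  `[\sum_(k < d | (k < i)%N) lam k, \sum_(k < d | (k <= i)%N) lam k[%R.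

(* The intervals are pairwise disjoint and cover [0, 1) when lam is a length
   data, so the choice of i is unique there; the value outside [0, 1) is
   irrelevant. *)
Definition iet lam pi (x : R) : R :=
  if [pick i | x \in iet_interval lam i] is Some i then
    x - \sum_(k < d | (k < i)%N) lam k + \sum_(k < d | (pi k < pi i)%N) lam k
  else x.

(* The inverse of T as a self-map of [0, 1). *)
Definition iet_inv lam pi : R -> R := 'pinv_(fun=> 0) `[0, 1[ (iet lam pi).

(* With 0-based values of pi, the condition pi(k) <= i reads pi k < i. *)
Definition alpha lam pi (i : nat) : R := \sum_(k < d | (pi k < i)%N) lam k.

Definition backward_orbit lam pi (i : nat) : set R :=
  [set iter n (iet_inv lam pi) (alpha lam pi i) | n in [set n | (1 <= n)%N]].

(* As T is a bijection of [0, 1), the backward orbit of alpha_i is defined as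
   soon as alpha_i lies in [0, 1); alpha_i = 1 can only occur when some
   lengths vanish. *)
Definition idoc lam pi : Prop :=
  let D := [set i : nat | (1 <= i < d)%N] in
  [/\ forall i, D i -> alpha lam pi i \in `[0, 1[%R,
      forall i, D i -> infinite_set (backward_orbit lam pi i)
    & trivIset D (backward_orbit lam pi)].

End IntervalExchange.

Section Gaps.
Variables (R : realType) (T : R -> R) (N : nat).

Definition orbit_points : seq R := sort <=%R [seq iter n T 0 | n <- iota 0 N].

(* The default value 1 of nth implements the convention y_N = 1. *)
Definition gap (i : nat) : R := nth 1 orbit_points i.+1 - nth 1 orbit_points i.

Definition Gaps : set R := [set gap i | i in `I_N].

End Gaps.

(* Main.v *)
(* T maps a gap ]x, y[ between neighbouring orbit points T^a(0) and T^b(0)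
   isometrically onto a gap, unless a = N-1, or ]x, y] contains T^(N-1)(0), one
   of the d-1 division points of the intervals, or 1.  As the ]x, y] are disjoint,
   at most d+2 gaps are exceptional; a increases along the images of a gap, so
   every gap length is the length of an exceptional gap.  The i.d.o.c. serves only
   to make the orbit of 0 injective and lambda_1 positive. *)
Require Import Defs.
From mathcomp Require Import lra.
Import Order.TTheory GRing.Theory Num.Theory.
Local Open Scope ring_scope.
Local Open Scope classical_set_scope.
Local Open Scope card_scope.

Set Implicit Arguments.
Unset Strict Implicit.
Unset Printing Implicit Defensive.

(** * Partial sums of the lengths: the end points of the intervals *)

Definition psum (R : realType) (d : nat) (lam : 'I_d -> R) (m : nat) : R :=
  \sum_(k < d | (k < m)%N) lam k.

Section PartialSums.
Variables (R : realType) (d : nat) (lam : 'I_d -> R).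

Lemma psum0 : psum lam 0 = 0.
Proof. by rewrite /psum big_pred0. Qed.

Lemma psumS (i : 'I_d) : psum lam i.+1 = psum lam i + lam i.
Proof.
rewrite /psum (bigD1 i) //= addrC; congr (_ + _).
by apply: eq_bigl => k; rewrite ltnS ltn_neqAle andbC.
Qed.

Lemma psum_full : psum lam d = \sum_(k < d) lam k.
Proof. by apply: eq_bigl => k; rewrite ltn_ord. Qed.

Lemma psum_cell m x : (m <= d)%N -> 0 <= x < psum lam m ->
  exists i : 'I_d, psum lam i <= x < psum lam i.+1.
Proof.
elim: m => [|m IHm] lemd /andP[x0 xm].
  by move: xm; rewrite psum0 ltNge x0.
have [xm'|mx] := ltP x (psum lam m).
  by apply: IHm; rewrite ?x0 // ltnW.
by exists (Ordinal lemd); rewrite mx.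
Qed.

Hypothesis lam_ge0 : forall i, 0 <= lam i.

Lemma psum_mono m n : (m <= n)%N -> psum lam m <= psum lam n.
Proof.
move=> mn; rewrite /psum big_mkcond [leRHS]big_mkcond; apply: ler_sum => k _.
case: ifP => [km|_]; first by rewrite (leq_trans km mn).
by case: ifP.
Qed.

Lemma psum_cell_inj (i j : 'I_d) x : psum lam i <= x < psum lam i.+1 ->
  psum lam j <= x < psum lam j.+1 -> i = j.
Proof.
move=> /andP[ix xi] /andP[jx xj]; apply: val_inj => /=.
case: (ltngtP i j) => // /psum_mono.
  by move=> /(lt_le_trans xi) /lt_le_trans /(_ jx); rewrite ltxx.
by move=> /(lt_le_trans xj) /lt_le_trans /(_ ix); rewrite ltxx.
Qed.

End PartialSums.

(** * Gaps in the orbit of 0 under an arbitrary map *)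

Section Orbit.
Variables (R : realType) (T : R -> R).

Definition orbit_pt (N : nat) (x : R) : Prop :=
  exists2 n : nat, (n < N)%N & x = iter n T 0.

(** Describes gaps without sorting; the alternative [y = 1] is the convention y_N = 1. *)
Definition adjacent (N : nat) (x y : R) : Prop :=
  [/\ orbit_pt N x, orbit_pt N y \/ y = 1, x < y
    & forall z, orbit_pt N z -> ~ (x < z < y)].

Definition gap_lengths (N : nat) : set R :=
  [set l | exists x y, adjacent N x y /\ l = y - x].

(** If [x < x'], then [x' < c <= y] puts the orbit point [x'] inside the gap from [x] to [y]. Hence
    a point [c] labels at most one gap. *)
Lemma adjacent_inj N x y x' y' c : adjacent N x y -> adjacent N x' y' ->
  x < c <= y -> x' < c <= y' -> x = x'.
Proof.
move=> [Ox _ _ nxy] [Ox' _ _ nxy'] /andP[xc cy] /andP[xc' cy'].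
have [xx'|xx'|//] := ltgtP x x'.
  by case: (nxy _ Ox'); rewrite xx' (lt_le_trans xc').
by case: (nxy' _ Ox); rewrite xx' (lt_le_trans xc).
Qed.

Lemma adjacent_functional N x y y' : adjacent N x y -> adjacent N x y' ->
  (forall z, orbit_pt N z -> z < 1) -> y = y'.
Proof.
move=> xy xy' lt1; wlog yy' : y y' xy xy' / y < y' => [wlg|].
  by have [/wlg->|/wlg->|] := ltgtP y y'.
have [_ Oy ltxy _] := xy; have [_ Oy' _ nxy'] := xy'.
case: Oy => [Oy|y1]; first by case: (nxy' _ Oy); rewrite ltxy.
have y'1 : y' <= 1 by case: Oy' => [/lt1/ltW|->].
by move: yy'; rewrite y1 ltNge y'1.
Qed.

Lemma Gaps_sub N : (forall z, orbit_pt N z -> z < 1) ->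
  (forall m n, (m < N)%N -> (n < N)%N -> iter m T 0 = iter n T 0 -> m = n) ->
  Gaps T N `<=` gap_lengths N.
Proof.
move=> lt1 inj _ [i /= iN <-]; rewrite /gap.
set s := orbit_points T N.
have ss : size s = N by rewrite /s size_sort size_map size_iota.
have us : uniq [seq iter n T 0 | n <- iota 0 N].
  rewrite map_inj_in_uniq ?iota_uniq // => m n.
  by rewrite !mem_iota /= !add0n; apply: inj.
have so : sorted <%R s by rewrite sort_lt_sorted.
have sO z : z \in s <-> orbit_pt N z.
  rewrite mem_sort; split=> [/mapP[n]|[n nN ->]].
    by rewrite mem_iota add0n => /andP[_ nN] ->; exists n.
  by apply: map_f; rewrite mem_iota add0n.
have Oi j : (j < N)%N -> orbit_pt N (nth 1 s j).
  by move=> jN; apply/sO/mem_nth; rewrite ss.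
exists (nth 1 s i), (nth 1 s i.+1); split=> //; split; first exact: Oi.
- have [?|?] := ltnP i.+1 N; first by left; apply: Oi.
  by right; rewrite nth_default // ss.
- have [?|?] := ltnP i.+1 N; last by rewrite [ltRHS]nth_default ?ss //; apply/lt1/Oi.
  by rewrite lt_sorted_ltn_nth ?inE ?ss.
- move=> z /sO /(nthP 1)[j]; rewrite ss => jN <- /andP[].
  rewrite lt_sorted_ltn_nth ?inE ?ss // => ij.
  have i1N : (i.+1 < N)%N by apply: leq_ltn_trans jN.
  by rewrite lt_sorted_ltn_nth ?inE ?ss // ltnS leqNgt ij.
Qed.

(* Label 0 marks the gap starting at the last orbit point, label k.+1 the gap
   whose half-open interval ]x, y] contains c k. *)
Definition labelled (N : nat) (c : nat -> R) (k : nat) (x y : R) : Prop :=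
  if k is k'.+1 then x < c k' <= y else x = iter N.-1 T 0.

(* Gap lengths propagate along a, so every length is that of a labelled gap. *)
Lemma card_gap_lengths N K (c : nat -> R) :
  (forall z, orbit_pt N z -> z < 1) ->
  (forall a y, (a.+1 < N)%N -> adjacent N (iter a T 0) y ->
     (exists2 k, (k < K)%N & iter a T 0 < c k <= y) \/
     adjacent N (iter a.+1 T 0) (iter a.+1 T 0 + (y - iter a T 0))) ->
  gap_lengths N #<= `I_(K.+1).
Proof.
move=> lt1 step.
pose S k := [set l | exists x y,
  [/\ adjacent N x y, labelled N c k x y & l = y - x]].
have Suniq k l l' : S k l -> S k l' -> l = l'.
  move=> [x [y [xy kxy ->]]] [x' [y' [xy' kxy' ->]]].
  have xx' : x = x'.
    by case: k kxy kxy' => [-> -> |k] //=; apply: (adjacent_inj xy xy').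
  by subst x'; rewrite (adjacent_functional xy xy').
(* By [Suniq] a label carries at most one length; [xget] picks it, with default 0 for a label
   without a gap. *)
suff sub : gap_lengths N `<=` [set xget 0 (S k) | k in `I_(K.+1)].
  by apply: card_le_trans (subset_card_le sub) _; apply: card_image_le.
(* Induction on a bound [m] for [N - a], as each step along the orbit increases [a]. *)
suff main m a y : (N - a <= m)%N -> (a < N)%N ->
    adjacent N (iter a T 0) y ->
    exists2 k, (k < K.+1)%N & S k (y - iter a T 0).
  move=> _ [x [y [xy ->]]]; have [[a aN xa] _ _ _] := xy.
  rewrite {}xa in xy *; have [k kK Sk] := main _ a y (leqnn _) aN xy.
  exists k => //; apply: (Suniq k) (Sk).
  by apply: (xgetPex 0); exists (y - iter a T 0).
elim: m a y => [|m IHm] a y Na aN xy.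
  by move: Na; rewrite leqn0 subn_eq0 leqNgt aN.
have [aN1|aN1] := ltnP a.+1 N; last first.
  have NE : N = a.+1 by apply/eqP; rewrite eqn_leq aN1 aN.
  exists 0 => //; exists (iter a T 0), y; split => //=.
  by rewrite [in RHS]NE.
case: (step a y aN1 xy) => [[k kK kxy]|/IHm []//].
  by exists k.+1 => //; exists (iter a T 0), y.
  by rewrite subnS -ltnS prednK ?subn_gt0.
by move=> k kK; rewrite addrAC subrr add0r; exists k.
Qed.

End Orbit.

(** * The interval exchange as an injective piecewise translation of [0, 1) *)

Section IntervalExchange.
Variables (R : realType) (d : nat) (lam : 'I_d -> R) (pi : 'S_d).
Hypothesis hlam : length_data lam.
Implicit Types (i j : 'I_d) (x z : R).

Let T := iet lam pi.
Let lam_ge0 i : 0 <= lam i. Proof. exact: hlam.1. Qed.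
Let plam i := lam ((pi^-1)%g i).
Let plam_ge0 i : 0 <= plam i. Proof. exact: lam_ge0. Qed.

(** Indexing by [pi k] makes [alpha] a partial sum, so the facts on [psum] also apply to the image
    intervals. *)
Lemma alphaE m : alpha lam pi m = psum (fun i => lam ((pi^-1)%g i)) m.
Proof.
rewrite /alpha /psum [RHS](reindex_inj (@perm_inj _ pi)) /=.
by apply: eq_bigr => k _; rewrite permK.
Qed.

Lemma psum_d1 : psum lam d = 1.
Proof. by rewrite psum_full hlam.2. Qed.

Lemma alpha_ge0 m : 0 <= alpha lam pi m.
Proof. exact: sumr_ge0. Qed.

Lemma alpha_mono m n : (m <= n)%N -> alpha lam pi m <= alpha lam pi n.
Proof. by rewrite !alphaE; apply: psum_mono. Qed.

Lemma alpha_d1 : alpha lam pi d = 1.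
Proof.
rewrite -hlam.2; apply: eq_bigl => k; exact: ltn_ord.
Qed.

Lemma alphaS i : alpha lam pi (pi i).+1 = alpha lam pi (pi i) + lam i.
Proof. by rewrite !alphaE psumS permK. Qed.

Lemma ietE i x : psum lam i <= x < psum lam i.+1 ->
  T x = x - psum lam i + alpha lam pi (pi i).
Proof.
move=> ix; rewrite /T /iet; case: pickP => [j jx|/(_ i)].
  rewrite in_itv /= in jx.
  by rewrite (psum_cell_inj lam_ge0 ix jx).
by rewrite in_itv /= => /negP.
Qed.

Lemma iet_cell i x : psum lam i <= x < psum lam i.+1 ->
  alpha lam pi (pi i) <= T x < alpha lam pi (pi i).+1.
Proof.
move=> ix; rewrite (ietE ix) alphaS; move: ix; rewrite psumS; lra.
Qed.

Lemma cell x : 0 <= x < 1 ->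
  exists i : 'I_d, psum lam i <= x < psum lam i.+1.
Proof. by rewrite -psum_d1; apply: psum_cell. Qed.

Lemma iet01 x : 0 <= x < 1 -> 0 <= T x < 1.
Proof.
move=> /cell[i /iet_cell /andP[h1 h2]]; rewrite (le_trans (alpha_ge0 _) h1).
by rewrite (lt_le_trans h2) // -alpha_d1 alpha_mono // ltn_ord.
Qed.

Lemma iter_iet01 n : 0 <= iter n T 0 < 1.
Proof. by elim: n => [|n IHn] /=; [rewrite lexx ltr01|apply: iet01]. Qed.

(** The image intervals are disjoint, so [T x] determines the interval of [x], and [T] is a
    translation there. *)
Lemma iet_inj x z : 0 <= x < 1 -> 0 <= z < 1 -> T x = T z -> x = z.
Proof.
move=> /cell[i ix] /cell[j jz] Txz.
have ij : i = j.
  apply: (@perm_inj _ pi); have := iet_cell ix; have := iet_cell jz.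
  by rewrite -Txz !alphaE => *; apply: (psum_cell_inj plam_ge0); eassumption.
subst j; move: Txz; rewrite (ietE ix) (ietE jz); lra.
Qed.

Lemma iet_invK x : 0 <= x < 1 -> iet_inv lam pi (T x) = x.
Proof.
move=> x01; apply: pinvKV; last by rewrite inE /= in_itv.
by move=> u v; rewrite !inE /= !in_itv; apply: iet_inj.
Qed.

(* On the cell of x, T is a translation, so injectivity makes T(z) avoid the
   translate of ]x, y[ as soon as z avoids ]x, y[. *)
Lemma iet_between i x y z : psum lam i <= x < psum lam i.+1 ->
  y <= psum lam i.+1 -> 0 <= z < 1 ->
  T x < T z < T x + (y - x) -> x < z < y.
Proof.
move=> ix yi z01; rewrite (ietE ix) => Tz.
(* The point of cell [i] that the translation carries to [T z]. *)
pose w := T z + psum lam i - alpha lam pi (pi i).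
have iw : psum lam i <= w < psum lam i.+1 by rewrite /w; lra.
have wz : w = z.
  apply: iet_inj => //; last by rewrite (ietE iw) /w; lra.
  have := psum_mono lam_ge0 (ltn_ord i); rewrite psum_d1.
  have : 0 <= psum lam i by apply: sumr_ge0.
  lra.
rewrite -wz /w; lra.
Qed.

(** Allowing [y] to be the right end of the cell covers the gap ending at 1, whose translate may end
    at an orbit point other than [T y]. *)
Lemma adjacent_iet N a y i : (a.+1 < N)%N -> adjacent T N (iter a T 0) y ->
  psum lam i <= iter a T 0 < psum lam i.+1 -> y <= psum lam i.+1 ->
  orbit_pt T N (T (iter a T 0) + (y - iter a T 0)) ->
  adjacent T N (iter a.+1 T 0) (iter a.+1 T 0 + (y - iter a T 0)).
Proof.
move=> aN [_ _ xy nxy] ix yi Oy; split; first by exists a.+1.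
- by left.
- by rewrite ltrDl subr_gt0.
- move=> _ [[|n] nN ->] /=.
    (* For [n = 0] there is no predecessor to pull back to, but 0 cannot exceed [iter a.+1 T 0]. *)
    have := iter_iet01 a.+1; rewrite /=; lra.
  move=> /(iet_between ix yi (iter_iet01 n)); apply: nxy.
  by exists n => //; apply: ltnW.
Qed.

(** * Injectivity of the orbit of 0 from irreducibility and the i.d.o.c *)

Section Irreducible.
Variable hd : (2 <= d)%N.
Hypothesis hpi : irreducible_perm pi.
Hypothesis hidoc : idoc lam pi.

Let i0 := first_idx hd.

(** Irreducibility at k = 1; it makes [pi i0] one of the indices 1, ..., d-1 of the i.d.o.c. *)
Lemma pi_first_gt0 : (0 < pi i0)%N.
Proof.
rewrite lt0n; apply/eqP => p0; have := hpi (k := 1); rewrite hd => /(_ isT)/eqP.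
apply; have -> : [set i : 'I_d | (i < 1)%N]%SET = [set i0]%SET.
  by apply/setP => i; rewrite !inE ltnS leqn0.
by rewrite imset_set1; congr [set _]%SET; apply: val_inj.
Qed.

(** Otherwise [alpha] agrees at [pi i0] and [(pi i0).+1]: two backward orbits meet or, if
    [(pi i0).+1 = d], the value at [pi i0] is 1, outside [0, 1). *)
Lemma lam_first_gt0 : 0 < lam i0.
Proof.
have [in01 _ disj] := hidoc; have p0 := pi_first_gt0.
rewrite lt0r lam_ge0 andbT; apply/eqP => l0.
have aS : alpha lam pi (pi i0).+1 = alpha lam pi (pi i0) by rewrite alphaS l0 addr0.
have pd := ltn_ord (pi i0).
have [pd1|pd1] := ltnP (pi i0).+1 d; last first.
  have := in01 (pi i0); rewrite /= p0 pd => /(_ isT).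
  have pE : (pi i0).+1 = d by apply/eqP; rewrite eqn_leq pd pd1.
  by rewrite -aS pE alpha_d1 in_itv /= ltxx andbF.
have /(_ (pi i0).+1 (pi i0)) := disj; rewrite /= p0 pd pd1 => /(_ isT isT) h.
suff /h /eqP : backward_orbit lam pi (pi i0).+1 `&` backward_orbit lam pi (pi i0) !=set0.
  by rewrite eqn_leq ltnn.
exists (iet_inv lam pi (alpha lam pi (pi i0))).
by split; exists 1 => //=; rewrite aS.
Qed.

Lemma iet0 : T 0 = alpha lam pi (pi i0).
Proof.
rewrite (@ietE i0) ?psumS psum0 ?subrr ?add0r // lexx.
exact: lam_first_gt0.
Qed.

(** If the orbit of 0 closed up, the backward orbit of [T 0], which is [alpha lam pi (pi i0)], would
    stay in a finite cycle. *)
Lemma iet_aperiodic p : (0 < p)%N -> iter p T 0 <> 0.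
Proof.
move=> p0 Tp0; have [_ inf _] := hidoc.
have := inf (pi i0); rewrite /= pi_first_gt0 ltn_ord => /(_ isT); apply.
apply: (@sub_finite_set _ _ [set iter k T 0 | k in `I_p]); last first.
  exact/finite_image/finite_II.
move=> _ [[//|n] _ <-]; rewrite -iet0 iterSr (iet_invK (iter_iet01 0)).
elim: n => [|n [k kp /= <-]]; first by exists 0.
case: k kp => [|k] kp; last first.
  by exists k; [apply: ltnW | rewrite /= (iet_invK (iter_iet01 k))].
(* The preimage of 0 = T^p 0 in the cycle is T^(p-1) 0. *)
exists p.-1; first by rewrite /= ltn_predL.
by rewrite -[in RHS]Tp0 -(ltn_predK p0) /= (iet_invK (iter_iet01 _)).
Qed.

Lemma iter_iet_inj m n : iter m T 0 = iter n T 0 -> m = n.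
Proof.
wlog lemn : m n / (m <= n)%N => [wlg|].
  by case/orP: (leq_total m n) => [/wlg//|/wlg h /esym/h].
elim: m n lemn => [|m IHm] [|n] //.
  by move=> _ /esym/(@iet_aperiodic n.+1 isT).
rewrite ltnS => lemn /(iet_inj (iter_iet01 m) (iter_iet01 n)).
by move=> /(IHm _ lemn) ->.
Qed.

(** * Counting the exceptional gaps of the interval exchange *)

Lemma orbit_lt1 N z : orbit_pt T N z -> z < 1.
Proof. by move=> [n _ ->]; have /andP[] := iter_iet01 n. Qed.

Lemma Gaps_iet_sub N : Gaps T N `<=` gap_lengths T N.
Proof.
by apply: Gaps_sub; [exact: orbit_lt1 | move=> m n _ _; exact: iter_iet_inj].
Qed.

(* cut N k for 1 <= k < d are the division points of the intervals; cut N d = 1. *)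
Definition cut (N k : nat) : R := if k is 0 then iter N.-1 T 0 else psum lam k.

Lemma adjacent_uncut N a y i : (a.+1 < N)%N -> adjacent T N (iter a T 0) y ->
  psum lam i <= iter a T 0 < psum lam i.+1 -> y < psum lam i.+1 ->
  (iter a T 0 < cut N 0 <= y) \/
  adjacent T N (iter a.+1 T 0) (iter a.+1 T 0 + (y - iter a T 0)).
Proof.
move=> aN axy ix yi; have [_ Oy xy _] := axy.
have y1 : y < 1.
  by apply: lt_le_trans yi _; rewrite -psum_d1; apply: psum_mono.
have [b bN yE] : orbit_pt T N y by case: Oy => // y1'; move: y1; rewrite y1' ltxx.
have [bN1|bN1] := ltnP b.+1 N; last first.
  have NE : N = b.+1 by apply/eqP; rewrite eqn_leq bN1 bN.
  by left; rewrite NE /= -yE xy lexx.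
right; apply: (adjacent_iet aN axy ix (ltW yi)); exists b.+1 => //=.
have iy : psum lam i <= y < psum lam i.+1.
  by rewrite yi andbT; case/andP: ix => /le_trans + _; apply; apply: ltW.
rewrite -yE (ietE ix) (ietE iy); lra.
Qed.

Lemma card_gaps_le N : Gaps T N #<= `I_(d + 2).
Proof.
apply: card_le_trans (subset_card_le (@Gaps_iet_sub N)) _.
(* Label 0 and the d+1 points [cut N 0], ..., [cut N d] make d+2 labels. *)
rewrite addn2; apply: (card_gap_lengths (c := cut N) (@orbit_lt1 N)) => a y aN axy.
have [i ix] := cell (iter_iet01 a).
have [yi|yi] := ltP y (psum lam i.+1).
  by case: (adjacent_uncut aN axy ix yi) => h; [left; exists 0|right].
left; exists i.+1; first by rewrite ltnS.
by rewrite /= yi andbT; case/andP: ix.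
Qed.

(* Here T0 is the right end of the image of the last interval, so the gap ending
   at 1 is mapped onto a gap ending at T0 and the label 1 is not needed. *)
Lemma card_gaps_le_adj N :
  (pi^-1)%g (ord_pred (pi i0)) = last_idx hd -> Gaps T N #<= `I_(d + 1).
Proof.
move=> hl; apply: card_le_trans (subset_card_le (@Gaps_iet_sub N)) _.
(* [ord_pred] is cyclic; [pi_first_gt0] excludes the wrap-around. *)
have pil : (pi (last_idx hd)).+1 = pi i0 :> nat.
  rewrite -hl permKV /=; have p0 := pi_first_gt0.
  rewrite -(prednK p0) addSn /= modnDr modn_small //.
  by rewrite (leq_ltn_trans (leq_pred _)).
have lastE : (last_idx hd).+1 = d by rewrite /= subn1 prednK // ltnW.
rewrite addn1; apply: (card_gap_lengths (c := cut N) (@orbit_lt1 N)) => a y aN axy.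
have [i ix] := cell (iter_iet01 a).
have [yi|yi] := ltP y (psum lam i.+1).
  case: (adjacent_uncut aN axy ix yi) => h; last by right.
  by left; exists 0 => //; apply: ltnW.
have [id|id] := ltnP i.+1 d.
  by left; exists i.+1 => //; rewrite /= yi andbT; case/andP: ix.
have il : i = last_idx hd.
  by apply: val_inj; apply/eqP; rewrite -eqSS lastE eqn_leq id ltn_ord.
have pi1 : psum lam i.+1 = 1 by rewrite il lastE psum_d1.
have y1 : y = 1.
  apply/eqP; rewrite eq_le -{2}pi1 yi andbT.
  by have [_ [/orbit_lt1/ltW|->]] := axy.
right; apply: (adjacent_iet aN axy ix); first by rewrite pi1 y1.
(* The translated gap ends at [T 0], in the orbit segment because [a.+1 < N] gives [1 < N]. *)
exists 1; first exact: leq_ltn_trans aN.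
rewrite /= iet0 -pil -il alphaS (ietE ix) y1 -pi1 psumS; lra.
Qed.

End Irreducible.

End IntervalExchange.

Theorem theorem3 (R : realType) (d : nat) (hd : (2 <= d)%N)
    (lam : 'I_d -> R) (pi : 'S_d)
    (hlam : length_data lam) (hpi : irreducible_perm pi)
    (hidoc : idoc lam pi) (N : nat) (hN : (1 <= N)%N) :
  ((pi^-1)%g (ord_pred (pi (first_idx hd))) = last_idx hd ->
     Gaps (iet lam pi) N #<= `I_(d + 1)) /\
  ((pi^-1)%g (ord_pred (pi (first_idx hd))) <> last_idx hd ->
     Gaps (iet lam pi) N #<= `I_(d + 2)).
Proof.
by split=> hl; [apply: card_gaps_le_adj hl|apply: card_gaps_le].
Qed.
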